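(* If $G$ is a König–Egerváry graph, then $$a(G)-\alpha(G)\leq \mu(G)-\left\lceil\frac{\sqrt{8\mu(G)+1}-1}{2}\right\rceil .$$ This bound is exact for every prescribed value of the matching number: for every integer $\mu\geq 0$ there is a König–Egerváry graph $G$ with $\mu(G)=\mu$ attaining equality. Moreover, for every integer $\mu\geq 2$ there is a connected non-bipartite König–Egerváry graph $G$ with $\mu(G)=\mu$ attaining equality.
   Context: All graphs are finite, simple and undirected. For a graph $G$, $n(G)$ and $m(G)$ are the numbers of vertices and edges, $\alpha(G)$ is the independence number, and $\mu(G)$ is the matching number (maximum size of a set of pairwise disjoint edges). $G$ is a König–Egerváry graph if $\alpha(G)+\mu(G)=n(G)$. If $d_1\leq d_2\leq\cdots\leq d_n$ is the degree sequence of $G$, the annihilation number is $a(G)=\max\{k : \sum_{i=1}^k d_i\leq m(G)\}$. *)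

(* Defs.v *)
From mathcomp Require Export all_boot all_order all_algebra.
From mathcomp Require Export reals.

Set Implicit Arguments.
Unset Strict Implicit.
Unset Printing Implicit Defensive.

Record sgraph := SGraph {
  vertex :> finType;
  adj : rel vertex;
  adj_sym : symmetric adj;
  adj_irrefl : irreflexive adj }.

Section GraphInvariants.
Variable G : sgraph.
Implicit Types (x y : G) (S : {set G}) (M : {set {set G}}).

Definition edges : {set {set G}} :=
  [set [set p.1; p.2] | p : G * G & adj p.1 p.2].

Definition order_graph : nat := #|G|.
Definition size_graph : nat := #|edges|.

Definition independent S : bool :=
  [forall x in S, forall y in S, ~~ adj x y].
Definition independence_number : nat :=
  \max_(S : {set G} | independent S) #|S|.

(* Edges are nonempty sets, so [trivIset] is pairwise disjointness of
   distinct members. *)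
Definition matching M : bool := (M \subset edges) && trivIset M.
Definition matching_number : nat :=
  \max_(M : {set {set G}} | matching M) #|M|.

Definition konig_egervary : bool :=
  (independence_number + matching_number == order_graph)%N.

Definition degree x : nat := #|[set y | adj x y]|.

Definition degree_sequence : seq nat :=
  sort leq [seq degree x | x <- enum G].

(* The informal d_1, ..., d_n are the entries 0, ..., n-1 of the sequence; the
   index k ranges over 0, ..., n. *)
Definition annihilation_number : nat :=
  \max_(k < order_graph.+1
        | \sum_(i < k) nth 0 degree_sequence i <= size_graph) k.

Definition connected_graph : bool :=
  (0 < order_graph) && [forall x : G, forall y : G, connect (@adj G) x y].

Definition bipartite : bool :=
  [exists S : {set G}, independent S && independent (~: S)].

End GraphInvariants.

(* Main.v *)
(* Let A consist of a(G) vertices of smallest degree. Counting incidences gives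
   sum_(x in A) deg x + e(~: A) = m(G) + e(A), so e(A) <= e(~: A) <= C(k, 2)
   with k = n(G) - a(G), while a maximum matching leaves at least mu(G) - k
   edges within A. Hence mu(G) <= C(k + 1, 2), which says exactly that k is at
   least the rounded-up root. For equality, take a perfect matching with mu edges
   and, with r the rounded-up root, make r vertices on one of its sides adjacent
   to everything. These r vertices span C(r, 2) edges and the others only
   mu - r <= C(r, 2), so the incidence count gives a(G) >= n(G) - r. *)
Require Import Defs.
From mathcomp Require Import zify lra.
Import Order.TTheory GRing.Theory Num.Theory.

(** * Sums of the smallest values of a function *)

Lemma leq_sum_nth_subseq (t s : seq nat) :
  sorted leq s -> subseq t s -> \sum_(i < size t) nth 0 s i <= sumn t.
Proof.
elim: s t => [|x s IHs] [|y t] ; rewrite ?big_ord0 // => s_sorted.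
have {}IHs := IHs _ (path_sorted s_sorted).
move=> /=; case: (y =P x) => [-> /IHs IHt|_ sub_ts].
  by rewrite big_ord_recl /= leq_add2l.
(* If the head is skipped, [t] sits inside the tail, whose entries dominate those of the whole
   sorted sequence index by index. *)
apply: leq_trans (IHs _ sub_ts); apply: leq_sum => i _.
have lt_is : i < size s by apply: leq_trans (ltn_ord i) (size_subseq sub_ts).
by apply: (sorted_leq_nth leq_trans leqnn 0 s_sorted i i.+1);
  rewrite ?inE //= ltnW.
Qed.

(** Sorting preserves the subsequence relation, so the sorted values on [A] form a subsequence of
    the sorted values on [T]. *)
Lemma leq_sum_sorted_values (T : finType) (f : T -> nat) (A : {set T}) :
  \sum_(i < #|A|) nth 0 (sort leq [seq f x | x <- enum T]) i
    <= \sum_(x in A) f x.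
Proof.
have sorted_f s : sorted leq (sort leq s) by apply: sort_sorted leq_total _.
pose t := sort leq [seq f x | x <- enum A].
have sz_t : size t = #|A| by rewrite size_sort size_map -cardE.
rewrite -sz_t.
have -> : \sum_(x in A) f x = sumn t.
  rewrite (perm_sumn (permEl (perm_sort _ _))) sumnE big_map.
  by rewrite [in RHS]big_enum.
apply: leq_sum_nth_subseq => //; apply: subseq_sort => //.
- exact: leq_total.
- exact: leq_trans.
- by apply: map_subseq; rewrite {1}enumT; apply: filter_subseq.
Qed.

Lemma sum_sorted_valuesE (T : finType) (f : T -> nat) (k : nat) : k <= #|T| ->
  exists2 A : {set T}, #|A| = k
    & \sum_(i < k) nth 0 (sort leq [seq f x | x <- enum T]) i
      = \sum_(x in A) f x.
Proof.
(* Sorting the elements by their values, instead of the values themselves, makes the first [k] of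
   them a genuine set even when values repeat. *)
move=> le_kT; rewrite sort_map.
set s := sort _ _; have sz_s : size s = #|T| by rewrite size_sort -cardE.
have uniq_t : uniq (take k s) by rewrite take_uniq // sort_uniq enum_uniq.
have sz_t : size (take k s) = k by rewrite size_takel ?sz_s.
exists [set x in take k s]; first by rewrite cardsE (card_uniqP uniq_t).
rewrite (eq_bigl (mem (take k s))); last by move=> x; rewrite inE.
rewrite -big_uniq //= -(big_map f xpredT id) map_take (big_nth 0) big_mkord.
rewrite size_takel ?size_map ?sz_s //.
by apply: eq_bigr => i _; rewrite nth_take.
Qed.

(** * Incidence counts and the upper bound on the matching number *)

Section Graph.
Variable G : sgraph.
Implicit Types (x y : G) (A B e : {set G}) (M : {set {set G}}).

Definition edges_within A := [set e in edges G | e \subset A].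

Lemma edgeP e :
  reflect (exists x y, adj x y /\ e = [set x; y]) (e \in edges G).
Proof.
apply: (iffP imsetP) => [[[x y]]|[x [y [xy ->]]]].
  by rewrite inE => xy ->; exists x, y.
by exists (x, y); rewrite ?inE.
Qed.

Lemma card_edge e : e \in edges G -> #|e| = 2.
Proof.
case/edgeP=> x [y [xy ->]]; rewrite cards2.
by case: eqP xy => // ->; rewrite adj_irrefl.
Qed.


(** Mapping a neighbour [y] to [[set x; y]] is a bijection onto the edges at [x]. *)
Lemma degreeE x : degree x = #|[set e in edges G | x \in e]|.
Proof.
have inj_pair : {in [set y | adj x y] &, injective (fun y => [set x; y])}.
  move=> y z; rewrite !inE => xy xz /setP/(_ y).
  rewrite !inE eqxx orbT; case: eqP xy => [->|_ _]; first by rewrite adj_irrefl.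
  by move/esym/eqP.
rewrite /degree -(card_in_imset inj_pair); apply: eq_card => e.
rewrite inE; apply/imsetP/andP => [[y xy ->]|[/edgeP[u [v [uv ->]]]]].
  by rewrite !inE eqxx; split=> //; apply/edgeP; exists x, y; rewrite inE in xy.
rewrite !inE => /orP[]/eqP->; first by exists v; rewrite ?inE.
by exists u; rewrite ?inE 1?adj_sym // setUC.
Qed.

(* An edge e satisfies #|e :&: A| + [e misses A] = 1 + [e lies within A]. *)
Lemma sum_degreeE A :
  \sum_(x in A) degree x + #|edges_within (~: A)|
    = size_graph G + #|edges_within A|.
Proof.
have -> : \sum_(x in A) degree x = \sum_(e in edges G) #|e :&: A|.
  (* Double counting of the pairs formed by a vertex of [A] and an edge through it. *)
  under eq_bigr => x _ do rewrite degreeE -sum1_card.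
  under eq_bigr => x _ do (under eq_bigl => e do rewrite inE).
  rewrite (exchange_big_dep (mem (edges G))) /= => [|x e _ /andP[] //].
  apply: eq_bigr => e eE; rewrite sum1_card; apply: eq_card => x.
  by rewrite !inE /= unfold_in /= eE andbC.
have within B : #|edges_within B| = \sum_(e in edges G) (e \subset B).
  rewrite -big_mkcondr -sum1_card; apply: eq_bigl => e; by rewrite inE.
rewrite !within /size_graph -sum1_card -!big_split /=.
apply: eq_bigr => e /edgeP[x [y [xy ->]]].
have nxy : x != y by apply: contraTneq xy => ->; rewrite adj_irrefl.
rewrite !subUset !sub1set !inE setIUl cardsU.
have -> : [set x] :&: A :&: ([set y] :&: A) = set0.
  apply/setP=> z; rewrite !inE; case: eqP => // ->.
  by rewrite (negPf nxy) andbF.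
have card1I z : #|[set z] :&: A| = (z \in A).
  have [zA|zA] := boolP (z \in A).
    by rewrite (setIidPl _) ?cards1 // sub1set.
  by rewrite disjoint_setI0 ?cards0 // disjoints1.
by rewrite !card1I cards0; case: (x \in A); case: (y \in A).
Qed.

Lemma leq_card_edges_within A : #|edges_within A| <= 'C(#|A|, 2).
Proof.
rewrite -cards_draws; apply/subset_leq_card/subsetP => e.
by rewrite !inE => /andP[/card_edge-> ->].
Qed.

(** A matching edge not within [A] has an end outside [A], and disjoint edges have different such
    ends. *)
Lemma matching_leq_within M A :
  matching M -> #|M| <= #|edges_within A| + #|~: A|.
Proof.
case/andP=> /subsetP sME tM.
rewrite -(cardsID (edges_within A)); apply: leq_add.
  by apply/subset_leq_card/subsetIr.
apply: (@leq_trans (\sum_(e in M :\: edges_within A) #|e :&: ~: A|)).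
  rewrite -sum1_card; apply: leq_sum => e; rewrite !inE => /andP[nA eM].
  rewrite card_gt0 -setDE setD_eq0; apply: contra nA => ->.
  by rewrite sME.
apply: (@leq_trans (\sum_(e in M) #|e :&: ~: A|)).
  by rewrite [leqRHS](big_setID (edges_within A)) leq_addl.
under eq_bigr => e _.
  rewrite -sum1_card; under eq_bigl => x do rewrite inE.
  rewrite big_mkcondr /=; over.
(* Disjointness merges the double sum over edges and their vertices into one sum over [cover M]. *)
rewrite -big_trivIset // -big_mkcondr sum1_card.
by apply/subset_leq_card/subsetP => x /andP[].
Qed.

Lemma annihilation_number_leq_order : annihilation_number G <= #|G|.
Proof. by apply/bigmax_leqP => k _; rewrite -ltnS. Qed.

Lemma annihilation_number_sum :
  \sum_(i < annihilation_number G) nth 0 (degree_sequence G) i <= size_graph G.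
Proof.
pose P (k : 'I_#|G|.+1) :=
  \sum_(i < k) nth 0 (degree_sequence G) i <= size_graph G.
(* The index 0 is always admissible, so the maximum is attained rather than being the default value
   of an empty one. *)
have P0 : 0 < #|P|.
  by apply/card_gt0P; exists ord0; rewrite unfold_in /P big_ord0.
rewrite /annihilation_number.
by have [k Pk ->] := eq_bigmax_cond (fun k : 'I_#|G|.+1 => k : nat) P0.
Qed.

(** By [sum_degreeE] the hypothesis bounds the degree sum over [A] by the number of edges, and the
    [#|A|] smallest degrees sum to no more. *)
Lemma leq_annihilation_number A :
  #|edges_within A| <= #|edges_within (~: A)| -> #|A| <= annihilation_number G.
Proof.
move=> leA; have ltA : #|A| < #|G|.+1 by rewrite ltnS max_card.
apply: (leq_bigmax_cond (F := fun k : 'I_#|G|.+1 => k : nat) (Ordinal ltA)).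
apply: leq_trans (leq_sum_sorted_values _ (@degree G) A) _.
by have := sum_degreeE A; lia.
Qed.

Lemma matching_number_leq_bin :
  matching_number G <= 'C((#|G| - annihilation_number G).+1, 2).
Proof.
have [A cardA sumA] := sum_sorted_valuesE _ (@degree G) _
  annihilation_number_leq_order.
have := annihilation_number_sum; rewrite /degree_sequence sumA => leAm.
have cardAC : #|~: A| = #|G| - annihilation_number G.
  by rewrite -cardA -(cardsC A) addKn.
apply/bigmax_leqP => M /matching_leq_within-/(_ A).
(* With k the size of [~: A], both edge counts are at most ['C(k, 2)], and adding the k vertices
   outside [A] gives ['C(k.+1, 2)] by Pascal's rule. *)
have := leq_card_edges_within (~: A).
have := sum_degreeE A; rewrite cardAC binS bin1; lia.
Qed.

End Graph.

(** * The rounded-up root as an inverse of triangular numbers *)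

Lemma ceil_sqrt_leqE (R : realType) (mu k : nat) :
  ((Num.ceil ((Num.sqrt (8 * mu%:R + 1) - 1) / 2 : R) <= k%:Z)
    = (mu <= 'C(k.+1, 2))%N)%R.
Proof.
have bin_k : ('C(k.+1, 2) * 2 = k.+1 * k)%N.
  by rewrite mulnC -mul_bin_diag bin1.
rewrite ceil_le_int -pmulrn ler_pdivrMr ?ltr0n // lerBlDr.
(* Both sides are nonnegative, so they may be squared; [8 mu + 1 <= (2 k + 1)^2] then amounts to
   [2 mu <= (k + 1) k]. *)
rewrite -[leLHS]ger0_norm ?sqrtr_ge0 // -[leRHS]ger0_norm; last first.
  by rewrite addr_ge0 ?mulr_ge0 ?ler0n.
rewrite -ler_sqr ?nnegrE ?normr_ge0 // !real_normK ?num_real //.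
rewrite sqr_sqrtr; last by rewrite addr_ge0 ?mulr_ge0 ?ler0n.
rewrite -!natrM !natr1 -natrX ler_nat.
by apply/idP/idP; nia.
Qed.

(** * The extremal graphs and their invariants *)

Section Extremal.
Variables mu r : nat.

(* The vertices (i, true) with i < r are universal; the only other edges join
   (i, true) to (i, false). *)
Definition hub (v : 'I_mu * bool) := (v.1 < r) && v.2.

Definition extremal_adj (u v : 'I_mu * bool) :=
  (u != v) && [|| hub u, hub v | u.1 == v.1].

Lemma extremal_adj_sym : symmetric extremal_adj.
Proof.
by move=> u v; rewrite /extremal_adj eq_sym orbCA (eq_sym u.1).
Qed.

Lemma extremal_adj_irrefl : irreflexive extremal_adj.
Proof. by move=> u; rewrite /extremal_adj eqxx. Qed.

Definition extremal := SGraph extremal_adj_sym extremal_adj_irrefl.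

Lemma card_extremal : #|extremal| = 2 * mu.
Proof. by rewrite card_prod card_ord card_bool mulnC. Qed.

(** Vertices with the same index are adjacent, so an independent set has at most one vertex per
    index; the vertices [(i, false)] attain this, as none of them is a hub. *)
Lemma extremal_independence : independence_number extremal = mu.
Proof.
apply/anti_leq/andP; split.
  apply/bigmax_leqP => S /forall_inP indS.
  have inj1 : {in S &, injective (fun v : extremal => v.1)}.
    move=> u v uS vS eq1; apply/eqP.
    have /forall_inP/(_ v vS) := indS u uS.
    by rewrite /= /extremal_adj eq1 eqxx !orbT andbT negbK.
  by rewrite -(card_in_imset inj1) -[leqRHS](card_ord mu) max_card.
pose S : {set extremal} := [set (i, false) | i : 'I_mu].
have <- : #|S| = mu by rewrite card_imset ?card_ord // => i j [].
apply: (leq_bigmax_cond (F := fun S : {set extremal} => #|S|)).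
apply/forall_inP => u /imsetP[i _ ->]; apply/forall_inP => v /imsetP[j _ ->].
rewrite /= /extremal_adj /hub !andbF /= negb_and negbK.
by case: (i =P j) => [->|]; rewrite ?eqxx ?orbT.
Qed.

Definition spoke (i : 'I_mu) : {set extremal} := [set (i, true); (i, false)].

Lemma spoke_disjoint i j : i != j -> [disjoint spoke i & spoke j].
Proof.
move=> nij; rewrite -setI_eq0; apply/eqP/setP => -[k b].
rewrite !inE !xpair_eqE.
by case: (k =P i) => // ->; rewrite (negPf nij) andbF.
Qed.

Lemma spoke_inj : injective spoke.
Proof.
move=> i j eqs; apply/eqP; apply: contraT => /spoke_disjoint.
by rewrite eqs -setI_eq0 setIid => /eqP/setP/(_ (j, true)); rewrite !inE eqxx.
Qed.

Lemma spoke_edge i : spoke i \in edges extremal.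
Proof.
apply/edgeP; exists (i, true), (i, false); split=> //.
by rewrite /= /extremal_adj xpair_eqE /= eqxx !orbT.
Qed.

(** Disjoint edges use two vertices each out of [2 * mu], and the spokes form a perfect matching. *)
Lemma extremal_matching : matching_number extremal = mu.
Proof.
apply/anti_leq/andP; split.
  apply/bigmax_leqP => M /andP[/subsetP sME tM].
  rewrite -(leq_pmul2l (ltn0Sn 1)) -card_extremal mulnC -sum_nat_const.
  rewrite (eq_bigr (fun e : {set extremal} => #|e|)).
    by rewrite (eqP tM) max_card.
  by move=> e /sME/card_edge->.
pose M := spoke @: 'I_mu.
have <- : #|M| = mu by rewrite card_imset ?card_ord //; apply: spoke_inj.
apply: (leq_bigmax_cond (F := fun M : {set {set extremal}} => #|M|)).
apply/andP; split.
  by apply/subsetP => e /imsetP[i _ ->]; apply: spoke_edge.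
apply/trivIsetP => e f /imsetP[i _ ->] /imsetP[j _ ->] nij.
by apply: spoke_disjoint; apply: contraNneq nij => ->.
Qed.

Lemma extremal_konig_egervary : konig_egervary extremal.
Proof.
rewrite /konig_egervary extremal_independence extremal_matching.
by rewrite /order_graph card_extremal mul2n addnn.
Qed.

Definition hubs : {set extremal} := [set v | hub v].

Lemma card_hubs : r <= mu -> #|hubs| = r.
Proof.
move=> le_r_mu.
have inj_f : injective (fun i : 'I_r => (widen_ord le_r_mu i, true)).
  by move=> i j [] /val_inj.
rewrite -[RHS]card_ord -(card_imset _ inj_f); apply: eq_card => -[i b].
rewrite inE /hub /=; apply/andP/imsetP => [[lt_ir b1]|[j _ [-> ->]]] //=.
by exists (Ordinal lt_ir) => //; congr pair => //; apply: val_inj.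
Qed.

Lemma edges_within_hubs : 'C(#|hubs|, 2) <= #|edges_within extremal hubs|.
Proof.
rewrite -cards_draws; apply/subset_leq_card/subsetP => e.
rewrite !inE => /andP[/[dup] sub_e -> /cards2P[u [v [nuv eq_e]]]].
rewrite andbT.
apply/edgeP; exists u, v; split => //.
move: sub_e; rewrite eq_e subUset !sub1set !inE => /andP[hub_u _].
by rewrite /= /extremal_adj nuv hub_u.
Qed.

Lemma edges_outside_hubs : #|edges_within extremal (~: hubs)| <= mu - r.
Proof.
pose J := [set i : 'I_mu | r <= i].
have cardJ : #|J| = mu - r.
  rewrite -[RHS]muln1 -sum_nat_const_nat big_geq_mkord -sum1_card.
  by apply: eq_bigl => i; rewrite inE.
rewrite -cardJ -(card_imset _ spoke_inj); apply/subset_leq_card/subsetP => e.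
rewrite inE => /andP[/edgeP[u [v [uv ->]]]].
rewrite subUset !sub1set !inE => /andP[nhub_u nhub_v].
move: uv nhub_u nhub_v.
rewrite /= /extremal_adj => /andP[nuv /or3P[->|->|/eqP]] //.
case: u v nuv => [i b] [j c] /= nuv eq_ij.
move: nuv; rewrite -{}eq_ij xpair_eqE eqxx /= => nbc nb nc.
(* The two ends share the index [i] and differ, so one of them is [(i, true)], which fails to be a
   hub only if [r <= i]. *)
have Ji : i \in J.
  by rewrite inE leqNgt; case: b c nbc nb nc => [] []; rewrite /hub ?andbT.
apply/imsetP; exists i => //.
by case: b c nbc {nb nc} => [] [] // _; rewrite /spoke // setUC.
Qed.

Lemma extremal_annihilation : r <= mu -> mu <= 'C(r.+1, 2) ->
  2 * mu - r <= annihilation_number extremal.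
Proof.
move=> le_r_mu; rewrite binS bin1 => le_mu.
have cardC : #|~: hubs| = 2 * mu - r.
  by rewrite -card_extremal -(cardsC hubs) (card_hubs le_r_mu) addKn.
(* The non-hubs serve as the low-degree set: they span at most [mu - r] edges, which is at most
   ['C(r, 2)], a lower bound for the edges among hubs. *)
rewrite -cardC; apply: leq_annihilation_number; rewrite setCK.
have := edges_outside_hubs; have := edges_within_hubs.
by rewrite (card_hubs le_r_mu); lia.
Qed.

Lemma extremal_connected : 0 < r -> 0 < mu -> connected_graph extremal.
Proof.
move=> r_gt0 mu_gt0; rewrite /connected_graph /order_graph card_extremal.
rewrite muln_gt0 mu_gt0 /=.
pose h : extremal := (Ordinal mu_gt0, true).
have hub_h : hub h by rewrite /hub /= r_gt0.
have conn_h (x : extremal) : connect (@adj extremal) h x.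
  have [->|nhx] := eqVneq h x; first exact: connect0.
  by apply: connect1; rewrite /= /extremal_adj nhx hub_h.
apply/forallP => x; apply/forallP => y; apply: connect_trans (conn_h y).
by rewrite (sym_connect_sym (@adj_sym extremal)).
Qed.

Lemma extremal_nonbipartite : 0 < r -> 1 < mu -> ~~ bipartite extremal.
Proof.
move=> r_gt0 mu_gt1; have mu_gt0 := ltnW mu_gt1.
(* The hub of index 0 and the two ends of the spoke of index 1 form a triangle. *)
pose h : extremal := (Ordinal mu_gt0, true).
pose u : extremal := (Ordinal mu_gt1, true).
pose v : extremal := (Ordinal mu_gt1, false).
have hu : adj h u by rewrite /= /extremal_adj /hub /= r_gt0.
have hv : adj h v by rewrite /= /extremal_adj /hub /= r_gt0.
have uv : adj u v by rewrite /= /extremal_adj /= eqxx !orbT.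
apply/existsP => -[S /andP[/forall_inP indS /forall_inP indSC]].
have sep x y : adj x y -> (x \in S) != (y \in S).
  move=> xy; apply/eqP; have [xS yS|xS yS] := boolP (x \in S).
    by have /forall_inP/(_ y (esym yS)) := indS x xS; rewrite xy.
  have xC : x \in ~: S by rewrite inE.
  have yC : y \in ~: S by rewrite inE -yS.
  by have /forall_inP/(_ y yC) := indSC x xC; rewrite xy.
by move: (sep _ _ hu) (sep _ _ hv) (sep _ _ uv); do 3!case: (_ \in S).
Qed.

End Extremal.

(** * The bound over the integers and its sharpness *)

Local Open Scope ring_scope.

Lemma konig_egervary_bound (R : realType) (G : sgraph) : konig_egervary G ->
  (annihilation_number G)%:Z - (independence_number G)%:Z
    <= (matching_number G)%:Z
       - Num.ceil ((Num.sqrt (8 * (matching_number G)%:R + 1) - 1) / 2 : R).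
Proof.
move=> /eqP; rewrite /order_graph => keG.
have := matching_number_leq_bin G; rewrite -(ceil_sqrt_leqE R).
(* This makes the truncated difference [#|G| - annihilation_number G] a true one; the order is then
   replaced by the independence number plus the matching number. *)
have := annihilation_number_leq_order G.
by set c := Num.ceil _; lia.
Qed.

(** The witness [r] is the rounded-up root itself. Its positivity is recorded because connectedness
    and the triangle require a hub. *)
Lemma extremal_sharp (R : realType) (mu : nat) : exists r : nat,
  ((0 < mu)%N -> (0 < r)%N) /\
  (annihilation_number (extremal mu r))%:Z
    - (independence_number (extremal mu r))%:Z
  = (matching_number (extremal mu r))%:Z
    - Num.ceil ((Num.sqrt (8 * (matching_number (extremal mu r))%:R + 1) - 1)
                  / 2 : R).
Proof.
pose c := Num.ceil ((Num.sqrt (8 * mu%:R + 1) - 1) / 2 : R).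
have c_ge0 : 0 <= c.
  by rewrite ceil_ge0; have := sqrtr_ge0 (8 * mu%:R + 1 : R); lra.
have c_le k : (c <= k%:Z) = (mu <= 'C(k.+1, 2))%N by apply: ceil_sqrt_leqE.
have [r eq_c] : exists r : nat, c = r%:Z by exists `|c|%N; rewrite gez0_abs.
have le_mu : (mu <= 'C(r.+1, 2))%N by rewrite -c_le eq_c.
have le_r : (r <= mu)%N.
  by rewrite -lez_nat -eq_c c_le binS bin1 leq_addl.
exists r; split; first by case: r le_mu {eq_c le_r} => //;
  rewrite bin_small // leqn0 => /eqP->.
(* The general bound gives one inequality; the other follows from [2 * mu - r] being a lower bound
   for the annihilation number. *)
apply/eqP; rewrite eq_le konig_egervary_bound ?extremal_konig_egervary //=.
have := extremal_annihilation _ _ le_r le_mu.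
rewrite extremal_matching extremal_independence -/c eq_c; lia.
Qed.

Theorem theoremB (R : realType) :
  (forall G : sgraph, konig_egervary G ->
     (annihilation_number G)%:Z - (independence_number G)%:Z
     <= (matching_number G)%:Z
        - Num.ceil ((Num.sqrt (8 * (matching_number G)%:R + 1) - 1) / 2 : R))
  /\
  (forall mu : nat, exists G : sgraph,
     [/\ konig_egervary G,
         matching_number G = mu
       & (annihilation_number G)%:Z - (independence_number G)%:Z
         = (matching_number G)%:Z
           - Num.ceil ((Num.sqrt (8 * (matching_number G)%:R + 1) - 1) / 2 : R)])
  /\
  (forall mu : nat, (2 <= mu)%N -> exists G : sgraph,
     [/\ connected_graph G,
         ~~ bipartite G,
         konig_egervary G,
         matching_number G = mu
       & (annihilation_number G)%:Z - (independence_number G)%:Z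
         = (matching_number G)%:Z
           - Num.ceil ((Num.sqrt (8 * (matching_number G)%:R + 1) - 1) / 2 : R)]).
Proof.
split; first exact: konig_egervary_bound.
split=> mu => [|mu_ge2]; have [r [r_gt0 sharp]] := extremal_sharp R mu;
  exists (extremal mu r); split=> //.
- exact: extremal_konig_egervary.
- exact: extremal_matching.
- by apply: extremal_connected; rewrite ?r_gt0 // ltnW.
- by apply: extremal_nonbipartite; rewrite ?r_gt0 // ltnW.
- exact: extremal_konig_egervary.
- exact: extremal_matching.
Qed.
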